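(* Let $a\geq 2$ be an integer. Define the formal power series / functions \[ E(X)=\frac{1-(1-X)\prod_{n=0}^{\infty}(1-X^{2^n})}{2X},\qquad E^{(k)}(X)=\frac{1+X^{2^k}-(1-X)\prod_{m=0}^{k-1}(1-X^{2^m})}{2X(1+X^{2^k})}\quad(k\ge 0), \] where the empty product (for $k=0$) equals $1$. Let $\mathcal{L}(a)=\{\limsup_{n\to\infty}\|\xi a^n\| : \xi\in\mathbb{R}\}$ and \[ \Xi(a)=\mathcal{L}(a)\cap\left(0,\tfrac1a E\!\left(\tfrac1a\right)\right]. \] Then \[ \Xi(a)=\left\{\tfrac1a E^{(k)}\!\left(\tfrac1a\right) : k=0,1,2,\ldots\right\}\cup\left\{\tfrac1a E\!\left(\tfrac1a\right)\right\}. \]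
   Context: $\|x\|$ denotes the distance from the real number $x$ to the nearest integer. *)

(* Defs.v *)
From HB Require Import structures.
From mathcomp Require Import all_boot all_order all_algebra.
From mathcomp Require Import all_classical all_reals all_analysis.

Set Implicit Arguments.
Unset Strict Implicit.
Unset Printing Implicit Defensive.

Import Order.TTheory GRing.Theory Num.Theory.
Import numFieldNormedType.Exports.

Local Open Scope classical_set_scope.
Local Open Scope ring_scope.

(* ||x||; the infimum is attained *)
Definition dist_int (R : realType) (x : R) : R :=
  inf [set `|x - m%:~R| | m in [set: int]].

(* The factors for n < k. *)
Definition prod_pow2 (R : realType) (X : R) (k : nat) : R :=
  \prod_(n < k) (1 - X ^+ (2 ^ n)%N).

(* Meaningful for 0 < |X| < 1, where the infinite product converges. *)
Definition Efun (R : realType) (X : R) : R :=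
  (1 - (1 - X) * limn (prod_pow2 X)) / (2 * X).

Definition Efun_trunc (R : realType) (k : nat) (X : R) : R :=
  (1 + X ^+ (2 ^ k)%N - (1 - X) * prod_pow2 X k)
    / (2 * X * (1 + X ^+ (2 ^ k)%N)).

(* The sequences involved take values in [0, 1/2], so the real-valued limn_sup
   is their usual limit superior. *)
Definition limsup_spectrum (R : realType) (a : nat) : set R :=
  [set limn_sup (fun n => dist_int (xi * a%:R ^+ n)) | xi in [set: R]].

Arguments limsup_spectrum : clear implicits.

Definition Xi (R : realType) (a : nat) : set R :=
  limsup_spectrum R a `&` `]0, a%:R^-1 * Efun (a%:R^-1)].
Arguments Xi : clear implicits.

(* Main.v *)
(* Let [X = 1 / a], let [e n] be the signed distance from [xi * a ^ n] to the
   nearest integer and [s n = +1, -1] its sign.  If the limit superior [L] is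
   positive and less than [X], then eventually [e n <> 0] and
   [v n = s n - 2 * e n] satisfies [v n = s n * (1 - X) + X * v n.+1]; so [v] is
   determined by the sign sequence, and [1 - 2 * L] is the limit inferior of [|v n|].
   If the signs come in opposite pairs (+-, -+), this limit inferior is
   [(1 - X) / (1 + X)] times that of the sequence of first members of the pairs
   at [X ^ 2].  Conversely, a limit inferior that is less than 1 but at least
   [1 - 2 X E(X) = prod_j (1 - X ^ 2 ^ j) / (1 + X ^ 2 ^ j)] rules out the words
   1000, 100100 and 1001010, which forces the signs to come eventually in such
   pairs.  Iterating, either a constant sequence is reached after [k + 1] steps,
   and [L = X E^(k)(X)], or the process never ends, and [L = X E(X)]; the latter
   value is realized by the Thue-Morse sequence. *)

Require Import Defs.
From HB Require Import structures.
From mathcomp Require Import all_boot all_order all_algebra.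
From mathcomp Require Import all_classical all_reals all_analysis.
From mathcomp Require Import ring lra.

Import Order.TTheory GRing.Theory Num.Theory.
Import numFieldNormedType.Exports.

Local Open Scope classical_set_scope.
Local Open Scope ring_scope.

(** * Limits inferior in epsilon form *)

Definition is_liminf {R : realType} (u : nat -> R) (l : R) : Prop :=
  (forall d : R, 0 < d -> exists N, forall n, (N <= n)%N -> l - d < u n) /\
  (forall (d : R) N, 0 < d -> exists2 n, (N <= n)%N & u n < l + d).

Lemma is_liminf_le {R : realType} (u : nat -> R) (l l' : R) :
  is_liminf u l -> is_liminf u l' -> l <= l'.
Proof.
move=> [ul _] [_ ul']; rewrite leNgt; apply/negP => l'l.
have d0 : 0 < (l - l') / 2 by lra.
have [N uN] := ul _ d0; have [n Nn un] := ul' _ N d0.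
by have := uN _ Nn; lra.
Qed.

Lemma is_liminf_unique {R : realType} (u : nat -> R) (l l' : R) :
  is_liminf u l -> is_liminf u l' -> l = l'.
Proof. by move=> ul ul'; apply/eqP; rewrite eq_le !(is_liminf_le u). Qed.

Lemma is_liminf_shift {R : realType} (u : nat -> R) (l : R) (k : nat) :
  is_liminf (fun n => u (k + n)%N) l <-> is_liminf u l.
Proof.
split=> -[ul lu]; split=> [d d0|d N d0].
- have [N uN] := ul d d0; exists (k + N)%N => n kn.
  rewrite -(subnKC (leq_trans (leq_addr N k) kn)); apply: uN.
  by rewrite leq_subRL ?(leq_trans _ kn) ?leq_addr.
- have [n Nn un] := lu d N d0; exists (k + n)%N => //.
  exact: leq_trans Nn (leq_addl _ _).
- have [N uN] := ul d d0; exists N => n Nn.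
  by apply: uN; exact: leq_trans Nn (leq_addl _ _).
- have [n Nn un] := lu d (k + N)%N d0.
  exists (n - k)%N; first by rewrite leq_subRL// (leq_trans _ Nn) ?leq_addr.
  by rewrite subnKC// (leq_trans _ Nn) ?leq_addr.
Qed.

(** The map [t -> 1 - 2 * t] reverses the order; boundedness makes the suprema of the tails genuine,
    and they decrease to [limn_sup u]. *)
Lemma limn_sup_is_liminf {R : realType} (u : nat -> R) :
  (forall n, 0 <= u n <= 1 / 2) ->
  is_liminf (fun n => 1 - 2 * u n) (1 - 2 * limn_sup u).
Proof.
move=> u01.
have hub N : has_ubound (sdrop u N).
  by exists (1 / 2) => _ [n _ <-]; case/andP: (u01 n).
have hsup N : has_sup (sdrop u N) by split => //; exists (u N); exists N => /=.
have nonincr : {homo sups u : n m / (n <= m)%N >-> m <= n}.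
  by apply: nonincreasing_sups; exists (1 / 2) => _ [n _ <-]; case/andP: (u01 n).
have lb : has_lbound (range (sups u)).
  exists 0 => _ [n _ <-]; apply: (@le_trans _ _ (u n)); first by case/andP: (u01 n).
  by apply: sup_upper_bound => //; exists n => /=.
have cv := nonincreasing_is_cvgn nonincr lb.
split=> [d d0|d N d0].
- have [N _ NS] : \forall n \near \oo, sups u n < limn_sup u + d / 2.
    by apply: (cvgr_lt (limn_sup u)); [exact: cv | lra].
  exists N => n Nn; have := NS _ (leqnn N) => /=.
  have : u n <= sups u N by apply: sup_upper_bound => //; exists n.
  by lra.
- have le_N : limn_sup u <= sups u N by exact: nonincreasing_cvgn_ge.
  have d2 : 0 < d / 2 by lra.
  have [_ [n Nn <-]] := sup_adherent d2 (hsup N).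
  by rewrite -/(sups u N) => un; exists n => //; move: un le_N; rewrite /sups /=; lra.
Qed.

(** * Distance to the nearest integer *)

Lemma dist_intE {R : realType} (x e : R) :
  x - e \is a Num.int -> `|e| <= 1 / 2 -> dist_int x = `|e|.
Proof.
move=> /intrP[m xm] e2; apply/eqP; rewrite eq_le; apply/andP; split.
- apply: ge_inf; first by exists 0 => _ [k _ <-].
  by exists m => //; rewrite -xm; congr `|_|; ring.
- apply: lb_le_inf; first by exists `|x - 0%:~R|, 0.
  move=> _ [k _ <-]; have [->|mk] := eqVneq k m; first by rewrite -xm opprB addrC subrK.
  have : 1 <= `|(m - k)%:~R : R|.
    by rewrite -intr_norm -[1]/(1%:~R) ler_int -gtz0_ge1 normr_gt0 subr_eq0 eq_sym.
  have -> : x - k%:~R = (m - k)%:~R + e by rewrite rmorphB /= -xm; ring.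
  have := lerB_normD ((m - k)%:~R : R) e; lra.
Qed.

Lemma nearest_int {R : realType} (x : R) :
  exists2 e, x - e \is a Num.int & `|e| <= 1 / 2.
Proof.
exists (x - (Num.floor (x + 1 / 2))%:~R); first by rewrite opprB addrC subrK intr_int.
have := floor_itv (x + 1 / 2); rewrite rmorphD /= ler_norml => /andP[]; lra.
Qed.

(** * The products behind [Efun_trunc] and [Efun] *)

Definition rho {R : realType} (X : R) : R := (1 - X) / (1 + X).

(** Product form of [1 - 2 * X * Efun_trunc k X], with the index raised by one; passing from [X] to
    [X ^+ 2] strips one factor. *)
Definition gap {R : realType} (k : nat) (X : R) : R :=
  \prod_(j < k) rho (X ^+ (2 ^ j)%N).

Definition gap_lim {R : realType} (X : R) : R := (1 - X) * limn (prod_pow2 X).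

Lemma sqr_half {R : realType} (X : R) : 0 < X <= 1 / 2 -> 0 < X ^+ 2 <= 1 / 2.
Proof. by move=> ?; apply/andP; split; nra. Qed.

Lemma pow2_half {R : realType} (X : R) k :
  0 < X <= 1 / 2 -> 0 < X ^+ (2 ^ k)%N <= 1 / 2.
Proof.
move=> X0; elim: k => [|k IH]; first by rewrite expr1.
by rewrite expnSr exprM; exact: sqr_half.
Qed.

Lemma rho_gt0 {R : realType} (X : R) : 0 < X <= 1 / 2 -> 0 < rho X.
Proof. by move=> X0; apply: divr_gt0; lra. Qed.

Lemma rho_lt1 {R : realType} (X : R) : 0 < X <= 1 / 2 -> rho X < 1.
Proof. by move=> X0; rewrite /rho ltr_pdivrMr; lra. Qed.

Lemma gap0 {R : realType} (X : R) : gap 0 X = 1.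
Proof. exact: big_ord0. Qed.

Lemma gapS {R : realType} k (X : R) : gap k.+1 X = rho X * gap k (X ^+ 2).
Proof.
rewrite /gap big_ord_recl expr1; congr (_ * _); apply: eq_bigr => i _.
by rewrite -exprM /= /bump add1n expnS.
Qed.

Lemma gap_gt0 {R : realType} k (X : R) : 0 < X <= 1 / 2 -> 0 < gap k X.
Proof. by move=> X0; apply: prodr_gt0 => i _; apply: rho_gt0; exact: pow2_half. Qed.

Lemma gapS_lt1 {R : realType} k (X : R) : 0 < X <= 1 / 2 -> gap k.+1 X < 1.
Proof.
elim: k X => [|k IH] X X0; rewrite gapS; first by rewrite gap0 mulr1 rho_lt1.
have := IH _ (sqr_half _ X0); have := rho_lt1 _ X0; have := rho_gt0 _ X0.
by have := gap_gt0 k.+1 _ (sqr_half _ X0); nra.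
Qed.

(** The bound passes from [X ^+ 2] to [X] because [(1 - X) (1 - 2 X^2)] exceeds [(1 - 2 X) (1 + X)]
    by [2 X^3]. *)
Lemma gap_ge {R : realType} k (X : R) : 0 < X <= 1 / 2 -> 1 - 2 * X <= gap k X.
Proof.
elim: k X => [|k IH] X X0; first by rewrite gap0; lra.
rewrite gapS; apply: (@le_trans _ _ (rho X * (1 - 2 * X ^+ 2))).
  by rewrite /rho mulrAC ler_pdivlMr; nra.
by rewrite ler_pM2l ?rho_gt0//; apply: IH; exact: sqr_half.
Qed.

(** Telescoping: with [Y = X ^ 2 ^ k], [rho Y * (1 - Y ^ 2) = (1 - Y) ^ 2], and one factor [1 - Y]
    joins the product on the right. *)
Lemma gap_prod_pow2 {R : realType} k (X : R) : 0 < X <= 1 / 2 ->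
  gap k X * (1 - X ^+ (2 ^ k)%N) = (1 - X) * prod_pow2 X k.
Proof.
move=> X0; rewrite /gap /prod_pow2; elim: k => [|k IH].
  by rewrite !big_ord0 expr1 mul1r mulr1.
rewrite !big_ord_recr /= mulrA -IH /rho expnSr exprM.
by have := pow2_half _ k X0 => Xk; field; lra.
Qed.

Lemma Efun_truncE {R : realType} k (X : R) : 0 < X <= 1 / 2 ->
  X * Efun_trunc k X = (1 - gap k.+1 X) / 2.
Proof.
move=> X0; rewrite /Efun_trunc -gap_prod_pow2//.
have -> : gap k.+1 X = gap k X * rho (X ^+ (2 ^ k)%N) by rewrite /gap big_ord_recr.
by have := pow2_half _ k X0 => Xk; rewrite /rho; field; lra.
Qed.

Lemma EfunE {R : realType} (X : R) : 0 < X ->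
  X * Efun X = (1 - gap_lim X) / 2.
Proof. by move=> X0; rewrite /Efun /gap_lim; field; lra. Qed.

Lemma gapSr_le {R : realType} k (X : R) : 0 < X <= 1 / 2 -> gap k.+1 X <= gap k X.
Proof.
move=> X0; rewrite /gap big_ord_recr /= ler_piMr//; first exact/ltW/gap_gt0.
by apply/ltW/rho_lt1/pow2_half.
Qed.

Lemma cvg_pow2 {R : realType} (X : R) : 0 < X <= 1 / 2 ->
  (fun k => X ^+ (2 ^ k)%N) @ \oo --> (0 : R).
Proof.
move=> X0; apply: (@squeeze_cvgr _ _ _ _ (fun=> 0) (fun k => X ^+ k)).
- near=> k; apply/andP; split; first by apply: exprn_ge0; lra.
  by apply: ler_wiXn2l; [lra|lra|rewrite ltnW// ltn_expl].
- exact: cvg_cst.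
- by apply: cvg_expr; rewrite gtr0_norm; lra.
Unshelve. all: by end_near.
Qed.

Lemma gap_cvg {R : realType} (X : R) : 0 < X <= 1 / 2 ->
  gap^~ X @ \oo --> gap_lim X.
Proof.
move=> X0.
have cg : cvgn (gap^~ X).
  apply: nonincreasing_is_cvgn.
    by apply/nonincreasing_seqP => k; exact: gapSr_le.
  by exists 0 => _ [k _ <-]; exact/ltW/gap_gt0.
(* Convergence of the infinite product is read off from that of [gap^~ X], since [1 - X ^ 2 ^ k]
   tends to 1. *)
have cP : prod_pow2 X @ \oo --> (1 - X)^-1 * (limn (gap^~ X) * (1 - 0)).
  have -> : prod_pow2 X =
      (fun k => (1 - X)^-1 * (gap k X * (1 - X ^+ (2 ^ k)%N))).
    by apply/funext => k; rewrite gap_prod_pow2// mulKf//; lra.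
  apply: cvgMr; apply: cvgM => //.
  by apply: cvgB; [exact: cvg_cst|exact: cvg_pow2].
rewrite /gap_lim (cvg_lim _ cP)// subr0 mulr1 mulVKf//; lra.
Qed.

Lemma gap_lim_le {R : realType} k (X : R) : 0 < X <= 1 / 2 -> gap_lim X <= gap k X.
Proof.
move=> X0; rewrite -(cvg_lim _ (gap_cvg _ X0))//.
apply: nonincreasing_cvgn_ge; last by apply/cvg_ex; exists (gap_lim X); exact: gap_cvg.
by apply/nonincreasing_seqP => j; exact: gapSr_le.
Qed.

Lemma gap_limS {R : realType} (X : R) : 0 < X <= 1 / 2 ->
  gap_lim X = rho X * gap_lim (X ^+ 2).
Proof.
move=> X0.
have c1 : (fun n => gap n.+1 X) @ \oo --> gap_lim X.
  by rewrite (cvg_shiftS (gap^~ X)); exact: gap_cvg.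
have c2 : (fun n => gap n.+1 X) @ \oo --> rho X * gap_lim (X ^+ 2).
  by under eq_fun do rewrite gapS; apply: cvgMr; exact/gap_cvg/sqr_half.
by rewrite -(cvg_lim _ c1)// (cvg_lim _ c2).
Qed.

Lemma gap_lim_ge {R : realType} (X : R) : 0 < X <= 1 / 2 -> 1 - 2 * X <= gap_lim X.
Proof.
move=> X0; rewrite -(cvg_lim _ (gap_cvg _ X0))//; apply: limr_ge.
  by apply/cvg_ex; exists (gap_lim X); exact: gap_cvg.
by near=> k; exact: gap_ge.
Unshelve. all: by end_near.
Qed.

(** Strictness puts [X E(X)] below [X], the range in which a real number can be decoded from
    signs. *)
Lemma gap_lim_gt {R : realType} (X : R) : 0 < X <= 1 / 2 -> 1 - 2 * X < gap_lim X.
Proof.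
move=> X0; rewrite gap_limS//.
apply: (@lt_le_trans _ _ (rho X * (1 - 2 * X ^+ 2))).
  rewrite /rho mulrAC ltr_pdivlMr; last by lra.
  have X3 : 0 < X ^+ 3 by apply: exprn_gt0; lra.
  have -> : (1 - X) * (1 - 2 * X ^+ 2) = (1 - 2 * X) * (1 + X) + 2 * X ^+ 3 by ring.
  by lra.
by rewrite ler_pM2l ?rho_gt0//; apply: gap_lim_ge; exact: sqr_half.
Qed.

Lemma gap_lim_lt1 {R : realType} (X : R) : 0 < X <= 1 / 2 -> gap_lim X < 1.
Proof. by move=> X0; apply: le_lt_trans (gap_lim_le 1 _ X0) (gapS_lt1 0 _ X0). Qed.

Lemma gap_approx {R : realType} (X d : R) : 0 < X <= 1 / 2 -> 0 < d ->
  exists k, gap k X < gap_lim X + d /\ X ^+ (2 ^ k)%N < d.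
Proof.
move=> X0 d0.
near \oo => k; exists k; split; near: k.
- by apply: (cvgr_lt (gap_lim X)); [exact: gap_cvg|by rewrite ltrDl].
- by apply: (cvgr_lt 0); [exact: cvg_pow2|].
Unshelve. all: by end_near.
Qed.

(** * Sequences coded by signs *)

(** [true] codes the sign -1. The bound excludes the unbounded solutions of the recursion, leaving
    [v n = (1 - X) * sum_i (-1) ^ w (n + i) * X ^ i]. *)
Definition coding {R : realType} (X : R) (w : nat -> bool) (v : nat -> R) : Prop :=
  (forall n, v n = (-1) ^+ w n * (1 - X) + X * v n.+1) /\
  (forall n, `|v n| <= 1).

Lemma ler_addexp {R : realType} (X B x y : R) : 0 < X <= 1 / 2 ->
  (forall k, x <= y + X ^+ k * B) -> x <= y.
Proof.
move=> X0 H.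
have cv : (fun k => y + X ^+ k * B) @ \oo --> y + 0 * B.
  apply: cvgD; first exact: cvg_cst.
  by apply: cvgMl; apply: cvg_expr; rewrite gtr0_norm; lra.
have -> : y = limn (fun k => y + X ^+ k * B) by rewrite (cvg_lim _ cv)// mul0r addr0.
apply: limr_ge; first by apply/cvg_ex; exists (y + 0 * B).
by near=> k; exact: H.
Unshelve. all: by end_near.
Qed.

(** The recursion improves any bound: [1 + X ^ k * B] becomes [1 + X ^ k.+1 * B]. *)
Lemma coding_of_bounded {R : realType} (X B : R) (w : nat -> bool) v : 0 < X <= 1 / 2 ->
  (forall n, v n = (-1) ^+ w n * (1 - X) + X * v n.+1) ->
  (forall n, `|v n| <= B) -> coding X w v.
Proof.
move=> X0 rec vB; split=> // n; apply: (@ler_addexp _ X B) => // k.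
elim: k n => [|k IH] n; first by rewrite expr0 mul1r; have := vB n; lra.
rewrite rec (le_trans (ler_normD _ _))// !normrM normr_sign mul1r.
rewrite (gtr0_norm (_ : 0 < X)) ?(gtr0_norm (_ : 0 < 1 - X)); [|lra|lra].
have : X * `|v n.+1| <= X * (1 + X ^+ k * B) by rewrite ler_pM2l ?IH//; lra.
by rewrite exprS; lra.
Qed.

Lemma coding_inj {R : realType} (X : R) (w : nat -> bool) v v' : 0 < X <= 1 / 2 ->
  coding X w v -> coding X w v' -> v =1 v'.
Proof.
move=> X0 [rec v1] [rec' v1'] n; apply/eqP; rewrite -subr_eq0 -normr_le0.
apply: (@ler_addexp _ X 2) => // k; rewrite add0r.
elim: k n => [|k IH] n.
  by rewrite (le_trans (ler_normB _ _))//; have := v1 n; have := v1' n; lra.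
have -> : v n - v' n = X * (v n.+1 - v' n.+1) by rewrite rec rec'; ring.
by rewrite normrM gtr0_norm ?exprS -?mulrA ?ler_pM2l ?IH//; lra.
Qed.

Lemma coding_exists {R : realType} (X : R) (w : nat -> bool) : 0 < X <= 1 / 2 ->
  exists v, coding X w v.
Proof.
move=> X0.
(* [lo k n] unrolls the recursion [k] times from the least tail value -1, so it increases with
   [k]. *)
pose lo := fix lo (k n : nat) {struct k} : R :=
  if k is k'.+1 then (-1) ^+ w n * (1 - X) + X * lo k' n.+1 else -1.
have lo_itv k n : -1 <= lo k n <= 1.
  elim: k n => [|k IH] n /=; first by apply/andP; lra.
  have /andP[] := IH n.+1; case: (w n); rewrite ?expr1 ?expr0 => ? ?; apply/andP; nra.
have lo_incr n : {homo lo^~ n : k m / (k <= m)%N >-> k <= m}.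
  apply/nondecreasing_seqP => k; elim: k n => [|k IH] n.
    by have /andP[] := lo_itv 1%N n.
  by rewrite /= lerD2l ler_pM2l; [exact: IH|lra].
have cv n : cvgn (lo^~ n).
  apply: nondecreasing_is_cvgn => //.
  by exists 1 => _ [k _ <-]; case/andP: (lo_itv k n).
exists (fun n => limn (lo^~ n)); split=> n; last first.
  rewrite ler_norml limr_ge ?limr_le//; near=> k; by case/andP: (lo_itv k n).
have c1 : (fun k => lo k.+1 n) @ \oo --> limn (lo^~ n).
  by rewrite (cvg_shiftS (lo^~ n)); exact: cv.
rewrite -(cvg_lim _ c1)//; apply: cvg_lim => //=.
apply: cvgD; first exact: cvg_cst.
by apply: cvgMr; exact: cv.
Unshelve. all: by end_near.
Qed.

Lemma coding_shift {R : realType} (X : R) (w : nat -> bool) v k : coding X w v ->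
  coding X (fun n => w (k + n)%N) (fun n => v (k + n)%N).
Proof. by move=> [rec v1]; split=> n //; rewrite rec addnS. Qed.

(** The leading term has size [1 - X >= X] and the rest at most [X], so [v n] never takes the sign
    opposite to [w n]. *)
Lemma coding_norm {R : realType} (X : R) (w : nat -> bool) v n : 0 < X <= 1 / 2 -> coding X w v ->
  `|v n| = (-1) ^+ w n * v n.
Proof.
move=> X0 [rec v1]; have := v1 n.+1; rewrite ler_norml => /andP[v1l v1r].
have := rec n; case: (w n); rewrite ?expr1 ?expr0 => vn.
  by rewrite mulN1r ler0_norm//; nra.
by rewrite mul1r ger0_norm//; nra.
Qed.

Lemma coding_norm_ge {R : realType} (X : R) (w : nat -> bool) v n : 0 < X <= 1 / 2 -> coding X w v ->
  1 - 2 * X <= `|v n|.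
Proof.
move=> X0 cv; rewrite (coding_norm _ _ _ _ X0 cv); case: cv => rec v1.
have := v1 n.+1; rewrite ler_norml => /andP[v1l v1r].
by rewrite rec mulrDr signrMK; case: (w n); rewrite ?expr1 ?expr0; nra.
Qed.

Lemma coding_liminf {R : realType} (X : R) (w : nat -> bool) v : coding X w v ->
  exists l, is_liminf (fun n => `|v n|) l.
Proof.
(* [u] inverts [t -> 1 - 2 * t] and lies in [0, 1/2], so its limit superior supplies the limit
   inferior. *)
move=> [_ v1]; pose u n := (1 - `|v n|) / 2.
have u01 n : 0 <= u n <= 1 / 2 by rewrite /u; have := v1 n; have := normr_ge0 (v n); lra.
exists (1 - 2 * limn_sup u); have := limn_sup_is_liminf _ u01.
by congr is_liminf; apply/funext => n; rewrite /u; field.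
Qed.

Lemma coding_liminf_itv {R : realType} (X : R) (w : nat -> bool) v l : 0 < X <= 1 / 2 -> coding X w v ->
  is_liminf (fun n => `|v n|) l -> 1 - 2 * X <= l <= 1.
Proof.
move=> X0 cv [vl lv]; apply/andP; split; rewrite leNgt; apply/negP => l1.
- have d0 : 0 < 1 - 2 * X - l by lra.
  have [n _ vn] := lv _ 0%N d0.
  by have := coding_norm_ge _ _ _ n X0 cv; lra.
- have d0 : 0 < l - 1 by lra.
  have [N vN] := vl _ d0; have := vN _ (leqnn N); have := cv.2 N; lra.
Qed.

Lemma coding_const {R : realType} (X : R) (w : nat -> bool) v : 0 < X <= 1 / 2 -> coding X w v ->
  (forall n, w n.+1 = w n) -> is_liminf (fun n => `|v n|) 1.
Proof.
move=> X0 cv wc; have w0 n : w n = w 0%N by elim: n => // n <-.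
have c0 : coding X w (fun=> (-1) ^+ w 0%N).
  split=> n; last by rewrite normr_sign.
  by rewrite w0; ring.
split=> [d d0|d N d0].
  by exists 0%N => n _; rewrite (coding_inj _ _ _ _ X0 cv c0) normr_sign; lra.
by exists N => //; rewrite (coding_inj _ _ _ _ X0 cv c0) normr_sign; lra.
Qed.

(** * Opposite pairs and the passage to [X ^+ 2] *)

(** Even-indexed values are at most [r] and odd-indexed ones at least [r], so the latter cannot
    lower the limit inferior. *)
Lemma is_liminf_even {R : realType} (u u' : nat -> R) (r l : R) : 0 < r ->
  (forall n, u n.*2 = r * u' n) -> (forall n, u' n <= 1) ->
  (forall n, r <= u n.*2.+1) ->
  is_liminf u' l <-> is_liminf u (r * l).
Proof.
move=> r0 ue u1 uo; split=> -[ul lu]; split=> [d d0|d N d0].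
- have dr : 0 < d / r by apply: divr_gt0.
  have [N uN] := ul _ dr; exists N.*2 => n Nn.
  have {}/uN : (N <= n./2)%N by rewrite -(doubleK N) half_leq.
  rewrite -(ltr_pM2l r0) mulrBr mulrCA divff ?gt_eqF// mulr1 => /lt_le_trans; apply.
  rewrite -[in leRHS](odd_double_half n); case: (odd n); last by rewrite add0n ue.
  by rewrite add1n (le_trans _ (uo _))// ler_piMr// ltW.
- have dr : 0 < d / r by apply: divr_gt0.
  have [n Nn] := lu _ N dr; rewrite -(ltr_pM2l r0) -ue mulrDr mulrCA divff ?gt_eqF// mulr1 => un.
  by exists n.*2 => //; rewrite (leq_trans Nn)// -addnn leq_addr.
- have [N uN] := ul _ (mulr_gt0 r0 d0); exists N => n Nn.
  have : (N <= n.*2)%N by rewrite (leq_trans Nn)// -addnn leq_addr.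
  by move=> /uN; rewrite ue -mulrBr ltr_pM2l.
- have [n Nn un] := lu _ N.*2 (mulr_gt0 r0 d0); exists n./2.
    by rewrite -(doubleK N) half_leq.
  rewrite -(ltr_pM2l r0) mulrDr; apply: le_lt_trans un.
  rewrite -[in leRHS](odd_double_half n); case: (odd n); last by rewrite add0n ue.
  by rewrite add1n (le_trans _ (uo _))// ler_piMr// ltW.
Qed.

Definition doubled (w : nat -> bool) : Prop := forall n, w n.*2.+1 = ~~ w n.*2.

(** Two steps of the recursion give [v n.*2 = s * (1 - X) ^ 2 + X ^ 2 * v n.+1.*2]; division by
    [rho X] turns [(1 - X) ^ 2] into [1 - X ^ 2]. *)
Lemma doubled_even {R : realType} (X : R) (w : nat -> bool) v v' n : 0 < X <= 1 / 2 ->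
  doubled w -> coding X w v -> coding (X ^+ 2) (fun n => w n.*2) v' ->
  v n.*2 = rho X * v' n.
Proof.
move=> X0 dw [rec v1] cv'.
have r0 := rho_gt0 _ X0.
suff c : coding (X ^+ 2) (fun n => w n.*2) (fun n => (rho X)^-1 * v n.*2).
  by rewrite -(coding_inj _ _ _ _ (sqr_half _ X0) c cv') mulVKf// gt_eqF.
apply: (@coding_of_bounded _ _ (rho X)^-1); first exact: sqr_half.
  move=> k; rewrite {1}rec {1}rec dw signrN doubleS.
  by rewrite /rho; field; lra.
by move=> k; rewrite normrM gtr0_norm ?invr_gt0// ler_piMr ?v1// invr_ge0 ltW.
Qed.

(** After a second member comes the first member of a pair, of size at most [rho X]; hence second
    members have size at least [1 - X - X * rho X = rho X]. *)
Lemma doubled_liminf {R : realType} (X l : R) (w : nat -> bool) v v' : 0 < X <= 1 / 2 ->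
  doubled w -> coding X w v -> coding (X ^+ 2) (fun n => w n.*2) v' ->
  is_liminf (fun n => `|v' n|) l <-> is_liminf (fun n => `|v n|) (rho X * l).
Proof.
move=> X0 dw cv cv'.
have r0 := rho_gt0 _ X0.
have ve n : v n.*2 = rho X * v' n by exact: doubled_even dw cv cv'.
apply: is_liminf_even => // n.
- by rewrite ve normrM gtr0_norm.
- exact: cv'.2.
rewrite (coding_norm _ _ _ _ X0 cv) cv.1 -doubleS ve mulrDr signrMK.
have rE : rho X * (1 + X) = 1 - X by rewrite /rho mulfVK//; lra.
have := cv'.2 n.+1; rewrite ler_norml => /andP[v1 v2].
have : X * rho X * - 1 <= X * rho X * v' n.+1 by rewrite ler_pM2l//; nra.
have : X * rho X * v' n.+1 <= X * rho X * 1 by rewrite ler_pM2l//; nra.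
by case: (w _); rewrite ?expr1 ?expr0; lra.
Qed.

Lemma doubled_liminf_coding {R : realType} (X l : R) (w : nat -> bool) v : 0 < X <= 1 / 2 ->
  doubled w -> coding X w v -> is_liminf (fun n => `|v n|) l ->
  exists w' v' l', [/\ coding (X ^+ 2) w' v', is_liminf (fun n => `|v' n|) l' &
                       l = rho X * l'].
Proof.
move=> X0 dw cv vl.
have [v' cv'] := @coding_exists _ _ (fun n => w n.*2) (sqr_half _ X0).
have [l' vl'] := coding_liminf _ _ _ cv'.
exists (fun n => w n.*2), v', l'; split=> //.
apply: is_liminf_unique vl _; exact/(doubled_liminf _ _ _ _ _ X0 dw cv cv').
Qed.

(** * Forbidden words *)

(* The bound on [|v n|] for signs +--+-+- followed by a tail of value 1; the
   bounds for the two other forbidden words are smaller. *)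
Definition threshold {R : realType} (X : R) : R :=
  (1 - X) * (1 - X - X ^+ 2 + X ^+ 3 - X ^+ 4 + X ^+ 5 - X ^+ 6) + X ^+ 7.

(** Peeling off three factors [rho] and using [gap_lim (X ^ 8) >= 1 - 2 * X ^ 8] leaves a polynomial
    inequality. *)
Lemma threshold_lt {R : realType} (X : R) : 0 < X <= 1 / 2 -> threshold X < gap_lim X.
Proof.
move=> X0.
have X2 := sqr_half _ X0; have X4 := sqr_half _ X2; have X8 := sqr_half _ X4.
rewrite (gap_limS _ X0) (gap_limS _ X2) (gap_limS _ X4).
have -> : X ^+ 2 ^+ 2 = X ^+ 4 by rewrite -exprM.
have {}X4 : 0 < X ^+ 4 <= 1 / 2 by move: X4; rewrite -exprM.
have -> : X ^+ 4 ^+ 2 = X ^+ 8 by rewrite -exprM.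
have {}X8 : 0 < X ^+ 8 <= 1 / 2 by move: X8; rewrite -!exprM.
have G8 := gap_lim_ge _ X8.
have -> : rho X * (rho (X ^+ 2) * (rho (X ^+ 4) * gap_lim (X ^+ 8))) =
    (1 - X) ^+ 2 * (1 - X ^+ 2) * (1 - X ^+ 4) * ((1 - X ^+ 8)^-1 * gap_lim (X ^+ 8)).
  by rewrite /rho; field; repeat (apply/andP; split); lra.
have q0 : 0 <= (1 - X) ^+ 2 * (1 - X ^+ 2) * (1 - X ^+ 4).
  by rewrite !mulr_ge0 ?sqr_ge0//; lra.
apply: (@lt_le_trans _ _ ((1 - X) ^+ 2 * (1 - X ^+ 2) * (1 - X ^+ 4) * (1 - 2 * X ^+ 8))); last first.
  apply: ler_wpM2l => //; apply: (le_trans G8).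
  by apply: ler_peMl; [apply: le_trans G8; lra|rewrite -div1r ler_pdivlMr; lra].
rewrite -subr_gt0 /threshold.
set p := (X in 0 < X).
(* In the first bracket, the term [2 * X ^ 3 * (1 - X)] keeps the sum positive at [X = 1 / 2], where
   [1 - 2 * X] vanishes. *)
have -> : p = X ^+ 6 * ((1 - 2 * X) * (2 - X ^+ 2) + 2 * X ^+ 3 * (1 - X)) +
   2 * X ^+ 8 * (1 - X) ^+ 2 * (1 - (1 - X ^+ 2) * (1 - X ^+ 4)).
  by rewrite /p /=; ring.
have X6 : 0 < X ^+ 6 by apply: exprn_gt0; lra.
have X3 : 0 < X ^+ 3 by apply: exprn_gt0; lra.
have A : 0 < (1 - 2 * X) * (2 - X ^+ 2) + 2 * X ^+ 3 * (1 - X).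
  have : 0 <= (1 - 2 * X) * (2 - X ^+ 2) by apply: mulr_ge0; lra.
  have : 0 < 2 * X ^+ 3 * (1 - X) by apply: mulr_gt0; lra.
  by lra.
have B : 0 <= 1 - (1 - X ^+ 2) * (1 - X ^+ 4) by nra.
have C : 0 <= 2 * X ^+ 8 * (1 - X) ^+ 2 by rewrite !mulr_ge0 ?sqr_ge0//; lra.
have := mulr_gt0 X6 A; have := mulr_ge0 C B; lra.
Qed.

(** Unroll [k] times and bound the tail by [X ^ k]. Multiplying by the sign at [n] treats a word and
    its complement together. *)
Lemma coding_le_prefix {R : realType} (X : R) (w : nat -> bool) v n k :
  0 < X <= 1 / 2 -> coding X w v ->
  `|v n| <= (1 - X) * (\sum_(i < k) (-1) ^+ (w n (+) w (n + i)%N) * X ^+ i) + X ^+ k.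
Proof.
move=> X0 cv; rewrite (coding_norm _ _ _ _ X0 cv).
suff -> : v n = (1 - X) * (\sum_(i < k) (-1) ^+ w (n + i)%N * X ^+ i) + X ^+ k * v (n + k)%N.
  rewrite mulrDr mulrCA big_distrr /=; apply: lerD.
    by under eq_bigr do rewrite mulrA -signr_addb.
  rewrite mulrCA ler_piMr//; first by apply: exprn_ge0; lra.
  by rewrite (le_trans (ler_norm _))// normrM normr_sign mul1r cv.2.
elim: k => [|k IH]; first by rewrite big_ord0 mulr0 add0r mul1r addn0.
by rewrite IH big_ord_recr /= exprSr addnS {1}cv.1; ring.
Qed.

(* [w n] is the letter 1, its negation the letter 0. *)
Lemma avoid1000 {R : realType} (X : R) (w : nat -> bool) v n : 0 < X <= 1 / 2 ->
  coding X w v -> threshold X < `|v n| ->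
  ~~ [&& w n.+1 != w n, w n.+2 != w n & w n.+3 != w n].
Proof.
move=> X0 cv vn; apply/negP => /and3P[w1 w2 w3]; move: vn; rewrite ltNge => /negP; apply.
apply: (le_trans (coding_le_prefix _ _ _ _ 4 X0 cv)).
rewrite !big_ord_recl big_ord0 /= /bump /= !addnS addn0.
rewrite addbb -!negb_eqb ![w n == _]eq_sym w1 w2 w3 /threshold -subr_ge0.
(* This is [threshold X] minus the prefix bound for 1000. *)
have : 0 <= 2 * X ^+ 3 * ((1 - 2 * X) + X ^+ 2 * (1 - X) + X ^+ 4).
  have X2 : 0 <= X ^+ 2 * (1 - X) by apply: mulr_ge0; [exact: sqr_ge0|lra].
  have [X3 X4] : 0 <= X ^+ 3 /\ 0 <= X ^+ 4 by split; apply: exprn_ge0; lra.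
  by apply: mulr_ge0; lra.
by congr (0 <= _); ring.
Qed.

Lemma avoid100100 {R : realType} (X : R) (w : nat -> bool) v n : 0 < X <= 1 / 2 ->
  coding X w v -> threshold X < `|v n| ->
  ~~ [&& w n.+1 != w n, w n.+2 != w n, w n.+3 == w n, w n.+4 != w n & w n.+4.+1 != w n].
Proof.
move=> X0 cv vn; apply/negP => /and5P[w1 w2 w3 w4 w5].
move: vn; rewrite ltNge => /negP; apply.
apply: (le_trans (coding_le_prefix _ _ _ _ 6 X0 cv)).
rewrite !big_ord_recl big_ord0 /= /bump /= !addnS addn0.
rewrite addbb -!negb_eqb ![w n == _]eq_sym w1 w2 w3 w4 w5 /threshold -subr_ge0.
have : 0 <= 2 * X ^+ 5 * (1 - X) ^+ 2.
  by apply: mulr_ge0; rewrite ?sqr_ge0// mulr_ge0// exprn_ge0//; lra.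
by congr (0 <= _); ring.
Qed.

Lemma avoid1001010 {R : realType} (X : R) (w : nat -> bool) v n : 0 < X <= 1 / 2 ->
  coding X w v -> threshold X < `|v n| ->
  ~~ [&& w n.+1 != w n, w n.+2 != w n, w n.+3 == w n, w n.+4 != w n &
         (w n.+4.+1 == w n) && (w n.+4.+2 != w n)].
Proof.
move=> X0 cv vn; apply/negP => /and5P[w1 w2 w3 w4 /andP[w5 w6]].
move: vn; rewrite ltNge => /negP; apply.
apply: (le_trans (coding_le_prefix _ _ _ _ 7 X0 cv)).
rewrite !big_ord_recl big_ord0 /= /bump /= !addnS addn0.
rewrite addbb -!negb_eqb ![w n == _]eq_sym w1 w2 w3 w4 w5 w6 /threshold -subr_ge0.
(* For 1001010 the prefix bound is [threshold X] itself. *)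
have : 0 <= (0 : R) by [].
by congr (0 <= _); ring.
Qed.

(** Up to complement, 100 must continue as 10011 or 1001011, so a block 011 starts two or four
    places later. Cutting into pairs from the first block on leaves only opposite pairs. *)
Lemma doubled_of_avoid (w : nat -> bool) (m : nat) :
  (forall n, ~~ [&& w n.+1 != w n, w n.+2 != w n & w n.+3 != w n]) ->
  (forall n, ~~ [&& w n.+1 != w n, w n.+2 != w n, w n.+3 == w n, w n.+4 != w n &
                    w n.+4.+1 != w n]) ->
  (forall n, ~~ [&& w n.+1 != w n, w n.+2 != w n, w n.+3 == w n, w n.+4 != w n &
                    (w n.+4.+1 == w n) && (w n.+4.+2 != w n)]) ->
  w m.+1 != w m -> exists j, doubled (fun n => w (j + n)%N).
Proof.
move=> F1 F2 F3 wm.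
(* If no two adjacent signs agree from [m] on, the signs alternate and the pairs may start at
   [m]. *)
have [[p [mp wp]]|alt] := pselect (exists p, (m <= p)%N /\ w p.+1 == w p); last first.
  exists m => n; rewrite addnS; have : w (m + n.*2).+1 != w (m + n.*2)%N.
    by apply/negP => H; apply: alt; exists (m + n.*2)%N; rewrite leq_addr.
  by do 2 case: (w _).
pose A j := (w j.+1 != w j) && (w j.+2 != w j).
have [j Aj] : exists j, A j.
  have : exists p, (m <= p)%N && (w p.+1 == w p) by exists p; rewrite mp.
  (* The least such [p] is [q.+1]; the signs at [q] and [q.+1] differ, so a block 100 starts at
     [q]. *)
  move=> /ex_minnP[[|q] /andP[mq wq] qmin].
    by move: mq wq wm; rewrite leqn0 => /eqP -> ->.
  exists q; rewrite /A (eqP wq) andbb; apply/negP => wq'.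
  have [E|mq'] := eqVneq m q.+1; first by move: wm; rewrite E wq.
  have := qmin q; rewrite wq' andbT ltnn => H.
  by move: mq mq'; rewrite leq_eqVlt => /orP[->//|]; rewrite ltnS => /H.
exists j.
have step i : A i -> A i.+2 \/ (w i.+3 != w i.+2 /\ A i.+4).
  by rewrite /A; move: (F1 i) (F2 i) (F3 i);
    case: (w i); case: (w i.+1); case: (w i.+2); case: (w i.+3);
    case: (w i.+4); case: (w i.+4.+1); case: (w i.+4.+2); rewrite //=; intuition.
(* Invariant: a block starts at the current pair, or this pair is opposite and a block starts at the
   next one. *)
suff H n : A (j + n.*2)%N \/ (w (j + n.*2).+1 != w (j + n.*2)%N /\ A (j + n.*2).+2).
  move=> n; rewrite addnS; have [/andP[]|[]] := H n; by do 2 case: (w _).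
elim: n => [|n [/step|[_]]]; [by rewrite addn0; left|rewrite doubleS !addnS..].
- by [].
- by left.
Qed.

(** * Descent to the possible limits inferior *)

(** As [l] exceeds [threshold X], the three words disappear from some index on; a sign change still
    occurs there, since constant signs give [l = 1]. *)
Lemma coding_eventually_doubled {R : realType} (X l : R) (w : nat -> bool) v :
  0 < X <= 1 / 2 -> coding X w v -> is_liminf (fun n => `|v n|) l ->
  gap_lim X <= l -> l < 1 -> exists j, doubled (fun n => w (j + n)%N).
Proof.
move=> X0 cv vl Gl l1; have tG := threshold_lt _ X0.
have d0 : 0 < l - threshold X by rewrite subr_gt0 (lt_le_trans tG).
have [N vN] := vl.1 _ d0.
have cN := coding_shift _ _ _ N cv.
have big n : threshold X < `|v (N + n)%N|.
  by have := vN _ (leq_addr n N); rewrite opprB addrC subrK.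
have [[m wm]|cst] := pselect (exists m, w (N + m.+1)%N != w (N + m)%N); last first.
  move: l1; have -> : l = 1; last by rewrite ltxx.
  apply: (is_liminf_unique (fun n => `|v (N + n)%N|)); first exact/(is_liminf_shift (fun n => `|v n|)).
  apply: (coding_const _ _ _ X0 cN) => n; apply/eqP/negPn/negP => wn.
  by apply: cst; exists n.
have [|||//|j dj] := @doubled_of_avoid (fun n => w (N + n)%N) m.
- by move=> n; exact: (avoid1000 _ _ _ _ X0 cN (big n)).
- by move=> n; exact: (avoid100100 _ _ _ _ X0 cN (big n)).
- by move=> n; exact: (avoid1001010 _ _ _ _ X0 cN (big n)).
by exists (N + j)%N => n; have := dj n; rewrite /= !addnA.
Qed.

(** Each passage to [X ^+ 2] strips a factor [rho X] from [l]. The descent stops at a limit inferior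
    1, which makes [l] some [gap j X], or reaches the trivial bound 1 after [k] passages. *)
Lemma coding_gap_or_le {R : realType} k (X l : R) (w : nat -> bool) v :
  0 < X <= 1 / 2 -> coding X w v -> is_liminf (fun n => `|v n|) l ->
  gap_lim X <= l -> (exists j, l = gap j X) \/ l <= gap k X.
Proof.
elim: k X l w v => [|k IH] X l w v X0 cv vl Gl.
  by right; rewrite gap0; have /andP[] := coding_liminf_itv _ _ _ _ X0 cv vl.
have [l1|] := ltP l 1; last first.
  have /andP[_ l1 l1'] := coding_liminf_itv _ _ _ _ X0 cv vl.
  by left; exists 0%N; rewrite gap0; apply/eqP; rewrite eq_le l1.
have [j dw] := coding_eventually_doubled _ _ _ _ X0 cv vl Gl l1.
have vlj := (is_liminf_shift (fun n => `|v n|) l j).2 vl.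
have [w' [v' [l' [cv' vl' ll']]]] :=
  doubled_liminf_coding _ _ _ _ X0 dw (coding_shift _ _ _ j cv) vlj.
have r0 := rho_gt0 _ X0.
move: Gl; rewrite gap_limS// ll' ler_pM2l// => Gl.
have [[i li]|lk] := IH _ _ _ _ (sqr_half _ X0) cv' vl' Gl.
  by left; exists i.+1; rewrite gapS li.
by right; rewrite gapS ler_pM2l.
Qed.

Lemma coding_liminf_cases {R : realType} (X l : R) (w : nat -> bool) v :
  0 < X <= 1 / 2 -> coding X w v -> is_liminf (fun n => `|v n|) l ->
  gap_lim X <= l -> (exists j, l = gap j X) \/ l = gap_lim X.
Proof.
move=> X0 cv vl Gl.
have [|nogap] := pselect (exists j, l = gap j X); [by left|right].
apply/eqP; rewrite eq_le Gl andbT; apply/ler_addgt0Pr => d d0.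
have [k [kd _]] := gap_approx _ _ X0 d0.
have [//|lk] := coding_gap_or_le k _ _ _ _ X0 cv vl Gl.
by rewrite (le_trans lk)// ltW.
Qed.

(** * Realizing the values *)

Lemma gap_realized {R : realType} k (X : R) : 0 < X <= 1 / 2 ->
  exists w v, coding X w v /\ is_liminf (fun n => `|v n|) (gap k X).
Proof.
elim: k X => [|k IH] X X0.
  have [v cv] := @coding_exists _ X (fun=> false) X0.
  by exists (fun=> false), v; split => //; rewrite gap0; exact: coding_const cv _.
have [w' [v' [cv' vl']]] := IH _ (sqr_half _ X0).
(* Replaces each sign by the pair formed of it and its opposite. *)
pose w n := w' n./2 (+) odd n.
have we : (fun n => w n.*2) = w'.
  by apply/funext => n; rewrite /w doubleK odd_double addbF.
have dw : doubled w.
  by move=> n; rewrite /w /= uphalf_double doubleK odd_double addbT addbF.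
have [v cv] := @coding_exists _ X w X0.
exists w, v; split=> //; rewrite gapS.
have cv2 : coding (X ^+ 2) (fun n => w n.*2) v' by rewrite we.
exact/(doubled_liminf _ _ _ _ _ X0 dw cv cv2).
Qed.

(** [k] is fuel: it limits the number of binary digits read, and [n] of them suffice for [n]. *)
Fixpoint digit_parity (k n : nat) : bool :=
  if k is k'.+1 then odd n (+) digit_parity k' n./2 else false.

Definition thue_morse (n : nat) : bool := digit_parity n n.

Lemma digit_parity_stable k m n : (n <= k)%N -> (n <= m)%N ->
  digit_parity k n = digit_parity m n.
Proof.
have dp0 j : digit_parity j 0 = false by elim: j.
elim: k m n => [|k IH] [|m] [|n]; rewrite ?dp0 //= => nk nm.
have n2 : (uphalf n <= n)%N by rewrite leq_uphalf_double -addnn leq_addr.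
by congr (_ (+) _); apply: IH; exact: leq_trans n2 _.
Qed.

Lemma thue_morse_rec n : thue_morse n = odd n (+) thue_morse n./2.
Proof.
case: n => // n; rewrite [LHS]/=; congr (_ (+) _).
by apply: digit_parity_stable; rewrite //= leq_uphalf_double -addnn leq_addr.
Qed.

Lemma thue_morse_double n : thue_morse n.*2 = thue_morse n.
Proof. by rewrite thue_morse_rec odd_double doubleK. Qed.

Lemma thue_morse_doubled : doubled thue_morse.
Proof.
by move=> n; rewrite thue_morse_double thue_morse_rec /= odd_double uphalf_double.
Qed.

(** First members of the pairs form the same sequence again, so [k] passages reduce the claim to the
    trivial bounds at [X ^ 2 ^ k]. *)
Lemma thue_morse_liminf_itv {R : realType} k (X l : R) v : 0 < X <= 1 / 2 ->
  coding X thue_morse v -> is_liminf (fun n => `|v n|) l ->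
  gap k X * (1 - 2 * X ^+ (2 ^ k)%N) <= l <= gap k X.
Proof.
elim: k X l v => [|k IH] X l v X0 cv vl.
  by rewrite gap0 mul1r expr1; exact: coding_liminf_itv cv vl.
have [v' cv'] := @coding_exists _ _ thue_morse (sqr_half _ X0).
have [l' vl'] := coding_liminf _ _ _ cv'.
have te : (fun n => thue_morse n.*2) = thue_morse.
  by apply/funext => n; exact: thue_morse_double.
have -> : l = rho X * l'.
  apply: is_liminf_unique vl _.
  have cv2 : coding (X ^+ 2) (fun n => thue_morse n.*2) v' by rewrite te.
  exact/(doubled_liminf _ _ _ _ _ X0 thue_morse_doubled cv cv2).
have r0 := rho_gt0 _ X0.
rewrite gapS -mulrA !ler_pM2l// expnS exprM.
exact: IH (sqr_half _ X0) cv' vl'.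
Qed.

Lemma thue_morse_liminf {R : realType} (X : R) v : 0 < X <= 1 / 2 ->
  coding X thue_morse v -> is_liminf (fun n => `|v n|) (gap_lim X).
Proof.
move=> X0 cv; have [l vl] := coding_liminf _ _ _ cv.
suff -> : gap_lim X = l by [].
have itv k := thue_morse_liminf_itv k _ _ _ X0 cv vl.
apply/eqP; rewrite eq_le; apply/andP; split; apply/ler_addgt0Pr => d d0.
- have d2 : 0 < d / 2 by lra.
  have [k [_ kd]] := gap_approx _ _ X0 d2.
  have /andP[lk _] := itv k.
  have Gk := gap_lim_le k _ X0.
  have g0 := gap_gt0 k _ X0.
  have g1 : gap k X <= 1 by rewrite -(gap0 X); case: (k) => // j; rewrite gap0; exact/ltW/gapS_lt1.
  have Y0 := pow2_half _ k X0.
  have : gap k X * X ^+ (2 ^ k)%N <= 1 * X ^+ (2 ^ k)%N by rewrite ler_pM2r//; lra.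
  by lra.
- have [k [kd _]] := gap_approx _ _ X0 d0.
  have /andP[_ lk] := itv k.
  by rewrite (le_trans lk)// ltW.
Qed.

(** * Between real numbers and codings *)

Lemma inv_nat_half {R : realType} (a : nat) : (2 <= a)%N -> 0 < (a%:R^-1 : R) <= 1 / 2.
Proof.
move=> a2; have a0 : 2 <= (a%:R : R) by rewrite ler_nat.
by rewrite invr_gt0 div1r lef_pV2 ?posrE; [apply/andP; split|..]; lra.
Qed.

Lemma int_lt1_eq0 {R : realType} (x : R) : x \is a Num.int -> `|x| < 1 -> x = 0.
Proof.
move=> /intrP[m ->]; rewrite -intr_norm -[1]/(1%:~R) ltr_int.
by rewrite ltNge -gtz0_ge1 normr_gt0 negbK => /eqP ->.
Qed.

Lemma half_sign_diff_int {R : realType} (b c : bool) :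
  ((-1) ^+ b - (-1) ^+ c) / 2 \is a @Num.int R.
Proof.
apply/intrP; exists (c%:Z - b%:Z); rewrite rmorphB /=.
by case: b; case: c; rewrite ?expr1 ?expr0 /=; field.
Qed.

(** Take [xi = e 0]: the recursion makes [a * e n - e n.+1] half a difference of two signs, an
    integer, so [e n] is the signed error of [xi * a ^ n]. *)
Lemma spectrum_of_coding {R : realType} (a : nat) (l : R) (w : nat -> bool) v :
  (2 <= a)%N -> coding a%:R^-1 w v -> is_liminf (fun n => `|v n|) l ->
  limsup_spectrum R a ((1 - l) / 2).
Proof.
move=> a2 cv vl; set X := a%:R^-1 in cv.
have X0 : 0 < X <= 1 / 2 := inv_nat_half _ a2.
have aX : a%:R * X = 1 by rewrite mulfV// pnatr_eq0; case: (a) a2.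
pose e n : R := ((-1) ^+ w n - v n) / 2.
have enorm n : `|e n| = (1 - `|v n|) / 2.
  have := cv.2 n; rewrite (coding_norm _ _ _ n X0 cv) => v1.
  have -> : e n = (-1) ^+ w n * ((1 - (-1) ^+ w n * v n) / 2).
    by rewrite /e mulrA mulrBr mulr1 signrMK.
  by rewrite normrM normr_sign mul1r ger0_norm//; lra.
have eint n : e 0%N * a%:R ^+ n - e n \is a Num.int.
  elim: n => [|n IH]; first by rewrite expr0 mulr1 subrr.
  have -> : e 0%N * a%:R ^+ n.+1 - e n.+1 =
      (e 0%N * a%:R ^+ n - e n) * a%:R + ((-1) ^+ w n - (-1) ^+ w n.+1) / 2.
    rewrite exprSr [in RHS]/e (cv.1 n) /e.
    have : a%:R * (X * v n.+1) = v n.+1 by rewrite mulrA aX mul1r.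
    have : a%:R * ((-1) ^+ w n * X) = (-1) ^+ w n by rewrite mulrCA aX mulr1.
    by move=> H1 H2; lra.
  apply: rpredD; first by apply: rpredM => //; exact: intr_nat.
  exact: half_sign_diff_int.
have e2 n : `|e n| <= 1 / 2 by rewrite enorm; have := normr_ge0 (v n); lra.
exists (e 0%N) => //.
have -> : (fun n => dist_int (e 0%N * a%:R ^+ n)) = (fun n => `|e n|).
  by apply/funext => n; exact: dist_intE.
have H : is_liminf (fun n => 1 - 2 * `|e n|) (1 - 2 * limn_sup (fun n => `|e n|)).
  by apply: limn_sup_is_liminf => n; rewrite normr_ge0 e2.
have := is_liminf_unique _ _ _ vl; move=> /(_ (1 - 2 * limn_sup (fun n => `|e n|))) ->.
  by field.
by congr is_liminf: H; apply/funext => n; rewrite enorm; field.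
Qed.

(** Below [1 / a], the products [a * e n] are eventually less than 1 in size, so the signs of [e n]
    and [e n.+1] fix the integer [a * e n - e n.+1]. *)
Lemma coding_of_spectrum {R : realType} (a : nat) (L : R) :
  (2 <= a)%N -> limsup_spectrum R a L -> 0 < L < a%:R^-1 ->
  exists w v, coding a%:R^-1 w v /\ is_liminf (fun n => `|v n|) (1 - 2 * L).
Proof.
move=> a2 [xi _]; set X := a%:R^-1.
have X0 : 0 < X <= 1 / 2 := inv_nat_half _ a2.
have aX : a%:R * X = 1 by rewrite mulfV// pnatr_eq0; case: (a) a2.
have : forall n, exists e, xi * a%:R ^+ n - e \is a Num.int /\ `|e| <= 1 / 2.
  by move=> n; have [e] := nearest_int (xi * a%:R ^+ n); exists e.
move=> /choice[e /all_and2[eint e2]].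
have -> : (fun n => dist_int (xi * a%:R ^+ n)) = (fun n => `|e n|).
  by apply/funext => n; exact: dist_intE.
move=> EL; have : is_liminf (fun n => 1 - 2 * `|e n|) (1 - 2 * L).
  by rewrite -EL; apply: limn_sup_is_liminf => n; rewrite normr_ge0 e2.
move=> {EL} eL L0.
have [N eX] : exists N, forall n, `|e (N + n)%N| < X.
  have d0 : 0 < 2 * (X - L) by lra.
  have [N eN] := eL.1 _ d0; exists N => n.
  by have := eN _ (leq_addr n N); lra.
have carry n : a%:R * e n - e n.+1 \is a Num.int.
  have -> : a%:R * e n - e n.+1 =
      (xi * a%:R ^+ n.+1 - e n.+1) - a%:R * (xi * a%:R ^+ n - e n).
    by rewrite exprS; ring.
  by rewrite rpredB// rpredM// intr_nat.
have aeX n : `|a%:R * e (N + n)%N| < 1.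
  rewrite normrM normr_nat -[ltRHS]aX ltr_pM2l// ltr0n; exact: leq_trans a2.
(* A zero error makes every later one an integer of size at most 1/2, hence zero, contradicting
   [0 < L]. *)
have e_neq0 n : e (N + n)%N != 0.
  apply/eqP => en.
  have ez m : e (N + n + m)%N = 0.
    elim: m => [|m IH]; first by rewrite addn0.
    have := carry (N + n + m)%N; rewrite IH mulr0 sub0r -addnS => /int_lt1_eq0.
    rewrite normrN => H; apply/eqP; rewrite -oppr_eq0 H//.
    by have := e2 (N + n + m.+1)%N; lra.
  have [|m nm] := eL.2 L (N + n)%N; first by lra.
  by rewrite -(subnKC nm) ez normr0; lra.
pose w n := e (N + n)%N < 0.
pose v n : R := (-1) ^+ w n - 2 * e (N + n)%N.
have sgn n : (-1) ^+ w n * `|e (N + n)%N| = e (N + n)%N.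
  rewrite /w; have [en|en] := ltP; first by rewrite ltr0_norm// expr1; ring.
  by rewrite ger0_norm// expr0 mul1r.
have vE n : v n = (-1) ^+ w n * (1 - 2 * `|e (N + n)%N|).
  by rewrite /v -[in LHS](sgn n); ring.
have vnorm n : `|v n| = 1 - 2 * `|e (N + n)%N|.
  rewrite vE normrM normr_sign mul1r ger0_norm//.
  by have := e2 (N + n)%N; lra.
exists w, v; split.
  split=> n; last by rewrite vnorm; have := normr_ge0 (e (N + n)%N); lra.
  (* [a * e] differs from half its sign by less than 1/2, and the next error from half its own by
     less than 1/2, so this integer is smaller than 1 in size. *)
  have digit : a%:R * e (N + n)%N - e (N + n).+1 - ((-1) ^+ w n - (-1) ^+ w n.+1) / 2 = 0.
    apply: int_lt1_eq0.
      by rewrite rpredB// half_sign_diff_int.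
    have := aeX n; have := e2 (N + n).+1; have := e_neq0 n; have := e_neq0 n.+1.
    have a0 : 0 < a%:R :> R by rewrite ltr0n; exact: leq_trans a2.
    have tlt : (a%:R * e (N + n)%N < 0) = (e (N + n)%N < 0) by exact: pmulr_rlt0.
    have tgt : (0 < a%:R * e (N + n)%N) = (0 < e (N + n)%N) by exact: pmulr_rgt0.
    rewrite /w addnS !ltr_norml !ler_norml !neq_lt => /orP[en1|en1] /orP[en|en];
      rewrite ?en1 ?en ?(lt_gtF en1) ?(lt_gtF en) ?expr1 ?expr0;
      have := en; rewrite -?tlt -?tgt; lra.
  rewrite /v addnS.
  have -> : e (N + n)%N = X * (a%:R * e (N + n)%N) by rewrite mulrA [X * _]mulrC aX mul1r.
  have -> : a%:R * e (N + n)%N = e (N + n).+1 + ((-1) ^+ w n - (-1) ^+ w n.+1) / 2.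
    by apply/eqP; rewrite -subr_eq0 opprD addrA digit.
  by field.
have := (is_liminf_shift _ _ N).2 eL.
by congr is_liminf; apply/funext => n; rewrite vnorm.
Qed.

Theorem theorem3p1 (R : realType) (a : nat) (ha : (2 <= a)%N) :
  Xi R a =
    [set (a%:R^-1 : R) * Efun_trunc k (a%:R^-1) | k in [set: nat]]
    `|` [set (a%:R^-1 : R) * Efun (a%:R^-1)].
Proof.
have X0 := @inv_nat_half R _ ha.
have G1 := gap_lim_lt1 _ X0.
have GX := gap_lim_gt _ X0.
rewrite /Xi EfunE; last by case/andP: X0.
apply/seteqP; split=> [L [LL]|L].
- rewrite /= in_itv /= => /andP[L0 LG].
  have [|w [v [cv vl]]] := coding_of_spectrum _ _ ha LL; first by lra.
  have Gl : gap_lim (a%:R^-1) <= 1 - 2 * L by lra.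
  (* [gap 0] is 1 and would give [L = 0]; [gap j.+1] corresponds to [Efun_trunc j]. *)
  have [[[|j] lj]|lG] := coding_liminf_cases _ _ _ _ X0 cv vl Gl.
  + by move: lj; rewrite gap0; lra.
  + by left; exists j => //; rewrite Efun_truncE// -lj; field.
  + by right => /=; lra.
- case=> [[k _ <-]|->].
  + rewrite Efun_truncE//.
    have [w [v [cv vl]]] := gap_realized k.+1 _ X0.
    split; first exact: spectrum_of_coding cv vl.
    rewrite /= in_itv /=.
    by have := gapS_lt1 k _ X0; have := gap_lim_le k.+1 _ X0; lra.
  + have [v cv] := @coding_exists _ _ thue_morse X0.
    split; first exact: spectrum_of_coding cv (thue_morse_liminf _ _ X0 cv).
    by rewrite /= in_itv /=; lra.
Qed.
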